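(* For every $n,\delta\in\mathbb{N}$ with $\delta\mid n$, the number of subgroups of exponent $\delta$ of $\mathbb{Z}_n\times\mathbb{Z}_n$ equals the number of cyclic subgroups of $\mathbb{Z}_\delta\times\mathbb{Z}_\delta$.
   Context: $\mathbb{N}=\{1,2,\ldots\}$. $\mathbb{Z}_n$ denotes the additive group of residue classes modulo $n$. *)

(* Defs.v *)
From mathcomp Require Import all_boot all_fingroup all_algebra all_solvable.

Set Implicit Arguments.
Unset Strict Implicit.
Unset Printing Implicit Defensive.

(* The direct product of two copies of the additive group of residue classes  *)
(* modulo n, for n > 0. The type 'Z_n has max(n, 2) elements, so for n = 1 it *)
(* is not the trivial group; its subgroup Zp n has exactly n elements for     *)
(* every n > 0 (it is all of 'Z_n if n > 1, and trivial if n = 1).            *)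
Definition ZxZ (n : nat) : {group 'Z_n * 'Z_n} := [group of setX (Zp n) (Zp n)].

(* Main.v *)
Require Import Defs.
From mathcomp Require Import all_boot all_fingroup all_algebra all_solvable.
From mathcomp Require Import ring.

(** Let d > 1 and equip V = Z_d x Z_d with the alternating form
    omega x y = x_1 y_2 - x_2 y_1. The orthogonal H |-> perp H restricts to a
    bijection between the subgroups of V of exponent d and the cyclic subgroups
    of V.

    Call v unimodular if omega v w = 1 for some w; then v, w is a basis of V
    and v has order d. Every element of V is a multiple of a unimodular one
    ([scal_unimodular]), so H has exponent d exactly when it contains a
    unimodular vector ([exponentE]). If v is such a vector, then perp H is
    contained in perp <v> = <v>, hence is cyclic. Conversely, if H is generated
    by k v with v unimodular, then v lies in perp H, which therefore has
    exponent d.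

    Both kinds of subgroups equal their double orthogonal. In a basis v, w a
    subgroup H of exponent d containing v is generated by v and m w for some m,
    a cyclic subgroup is generated by some k v, and in both cases the claim
    reduces to the fact that in Z_d an element killed by the annihilator of k
    is a multiple of k ([Zp_annihilator]).

    Finally, when n = m d, multiplication by m embeds Z_d x Z_d into Z_n x Z_n
    with image the d-torsion, which contains every subgroup of exponent d; so
    these subgroups may be counted in Z_d x Z_d. For d = 1 both sides count
    only the trivial subgroup. *)

Import GRing.Theory.
Local Open Scope ring_scope.

(** * Divisibility in the residue ring *)

Lemma Zp_natr_eq0 (d m : nat) : (1 < d)%N -> ((m%:R : 'Z_d) == 0) = (d %| m)%N.
Proof. by move=> d_gt1; rewrite -val_eqE /= val_Zp_nat. Qed.

(** In the residue ring, the annihilator of the annihilator of [k] is contained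
    in the ideal generated by [k]. *)
Lemma Zp_annihilator (d : nat) (k s : 'Z_d) : (1 < d)%N ->
  (forall t : 'Z_d, t * k = 0 -> t * s = 0) -> exists r, s = k * r.
Proof.
move=> d_gt1 ann; have d_gt0 : (0 < d)%N by apply: ltnW.
have g_gt0 : (0 < gcdn d k)%N by rewrite gcdn_gt0 d_gt0.
(* The annihilator of k is generated by d / gcd(d, k). *)
have /eqP : (d %/ gcdn d k)%:R * s = 0.
  apply: ann; apply/eqP; rewrite -[X in _ * X]natr_Zp -natrM Zp_natr_eq0 //.
  by rewrite mulnC gcdnC muln_divCA_gcd dvdn_mulr.
rewrite -[X in _ * X]natr_Zp -natrM Zp_natr_eq0 // => d_dvd.
have g_dvd : (gcdn d k %| s)%N.
  rewrite -(@dvdn_pmul2l (d %/ gcdn d k)) ?divnK ?dvdn_gcdl //.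
  by rewrite divn_gt0 // dvdn_leq ?dvdn_gcdl.
(* By Bezout, gcd(d, k) is a multiple of k modulo d. *)
have [a _ /dvdnP[b Eb]] := Bezoutl k d_gt0.
have Eg : (gcdn d k)%:R = - a%:R * k :> 'Z_d.
  apply/eqP; rewrite -subr_eq0 mulNr opprK -[X in _ * X]natr_Zp -natrM -natrD.
  by rewrite Eb Zp_natr_eq0 // dvdn_mull.
exists (- a%:R * (s %/ gcdn d k)%:R).
rewrite -[s in LHS]natr_Zp -{1}(divnK g_dvd) natrM Eg.
ring.
Qed.

(** * The alternating form on pairs of residues *)

Section Plane.

Variable d : nat.
Hypothesis d_gt1 : (1 < d)%N.

Local Notation V := ('Z_d * 'Z_d)%type.
Implicit Types (x y u v w h : V) (s t c : 'Z_d) (H K : {group V}).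

(** Multiplication of a pair by a residue. The group law on pairs is written
    multiplicatively, so [scal m%:R x] is the group power [x ^+ m]. *)
Definition scal c x : V := (c * x.1, c * x.2).

(** The determinant of the pair [x], [y]: a nondegenerate alternating form. *)
Definition omega x y : 'Z_d := x.1 * y.2 - x.2 * y.1.

Lemma pairMgE x y : (x * y)%g = (x.1 + y.1, x.2 + y.2).
Proof. by []. Qed.

Lemma pairXgE x m : (x ^+ m)%g = scal m%:R x.
Proof.
elim: m => [|m IHm]; first by rewrite expg0 /scal !mul0r.
by rewrite expgS IHm pairMgE /scal /= [m.+1%:R]mulrS !mulrDl !mul1r.
Qed.

Lemma scal_mem H c x : x \in H -> scal c x \in H.
Proof. by move=> Hx; rewrite -[c]natr_Zp -pairXgE groupX. Qed.

Lemma omegaDl x y z : omega (x * y)%g z = omega x z + omega y z.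
Proof. rewrite /omega pairMgE /=; ring. Qed.

Lemma omegaZl c x y : omega (scal c x) y = c * omega x y.
Proof. rewrite /omega /=; ring. Qed.

Lemma omegaZr c x y : omega x (scal c y) = c * omega x y.
Proof. rewrite /omega /=; ring. Qed.

Lemma omegaxx x : omega x x = 0.
Proof. rewrite /omega; ring. Qed.

Lemma omega_sym x y : omega x y = - omega y x.
Proof. rewrite /omega; ring. Qed.

(** Cramer's rule: [v] and [w] form a basis as soon as [omega v w = 1]. *)
Lemma omega_basis v w x : omega v w = 1 ->
  x = (scal (omega x w) v * scal (omega v x) w)%g.
Proof.
move=> vw1; rewrite pairMgE; case: x => a b; rewrite /omega /=.
by congr pair; [rewrite -[LHS]mulr1|rewrite -[LHS]mulr1];
   rewrite -vw1 /omega; ring.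
Qed.

(** Every vector is a multiple of a unimodular vector: divide its coordinates,
    seen as natural numbers, by their gcd. *)
Lemma scal_unimodular x : exists c v w, x = scal c v /\ omega v w = 1.
Proof.
have [a0|a_gt0] := posnP x.1.
  exists x.2, (0, 1), (-1, 0); split; last by rewrite /omega /=; ring.
  case: x a0 => a b /= a0; rewrite /scal /= mulr0 mulr1; congr pair.
  exact: val_inj.
set g := gcdn x.1 x.2; have g_gt0 : (0 < g)%N by rewrite gcdn_gt0 a_gt0.
have [p Ep] : exists p, x.1 = (p * g)%N :> nat by apply/dvdnP/dvdn_gcdl.
have [q Eq] : exists q, x.2 = (q * g)%N :> nat by apply/dvdnP/dvdn_gcdr.
have [e f E _] := egcdnP x.2 a_gt0.
have {}E : (e * p = f * q + 1)%N.
  apply/eqP; rewrite -(eqn_pmul2r g_gt0) mulnDl mul1n -!mulnA -Ep -Eq E.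
  exact: eqxx.
exists g%:R, (p%:R, q%:R), (f%:R, e%:R); split.
  by case: x @g g_gt0 Ep Eq {a_gt0 E} => a b g _ /= Ea Eb;
     rewrite /scal /= -!natrM ![(g * _)%N]mulnC -Ea -Eb !natr_Zp.
rewrite /omega /= -!natrM [(p * e)%N]mulnC E natrD [(q * f)%N]mulnC; ring.
Qed.

(** * Subgroups of maximal exponent *)

Lemma exponent_dvd H : (exponent H %| d)%N.
Proof.
by apply/exponentP=> x _; rewrite pairXgE /scal pchar_Zp // !mul0r.
Qed.

Lemma unimodular_order v w : omega v w = 1 -> #[v]%g = d.
Proof.
move=> vw1; apply/eqP; rewrite eqn_dvd; apply/andP; split.
  by rewrite -exponent_cycle exponent_dvd.
rewrite -Zp_natr_eq0 //; have : (#[v]%g)%:R * omega v w = 0.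
  by rewrite -omegaZl -pairXgE expg_order /omega /= !mul0r subr0.
by rewrite vw1 mulr1 => ->.
Qed.

(** A subgroup has exponent [d] exactly when it contains a unimodular vector. *)
Lemma exponentE H :
  reflect (exists v w, v \in H /\ omega v w = 1) (exponent H == d).
Proof.
apply: (iffP eqP) => [He|[v [w [Hv vw1]]]]; last first.
  apply/eqP; rewrite eqn_dvd exponent_dvd -{1}(unimodular_order _ _ vw1).
  exact: dvdn_exponent.
have cHH : abelian H.
  apply/centsP=> x _ y _; rewrite /commute !pairMgE.
  by congr pair; rewrite addrC.
have [x Hx Ex] := exponent_witness (abelian_nil cHH).
have [c [v [w [Dx vw1]]]] := scal_unimodular x.
(* c is a unit, since its annihilator kills x, which has order d; hence x is
   unimodular along with v. *)
have [|r r1] := @Zp_annihilator d c 1 d_gt1.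
  move=> t tc0; rewrite mulr1; apply/eqP.
  rewrite -[t]natr_Zp Zp_natr_eq0 // -[d in (d %| _)%N]He Ex order_dvdn.
  by rewrite pairXgE natr_Zp Dx /scal /= !mulrA tc0 !mul0r.
by exists x, (scal r w); split; rewrite // omegaZr Dx omegaZl vw1 mulr1 mulrC.
Qed.

(** * Orthogonal subgroups *)

(** The orthogonal of [A] for [omega]. *)
Definition perp_set (A : {set V}) := [set x | [forall h in A, omega x h == 0]].

Lemma perpP (A : {set V}) x :
  reflect (forall h, h \in A -> omega x h = 0) (x \in perp_set A).
Proof. by rewrite inE; apply: (iffP 'forall_in_eqP). Qed.

Lemma perp_group_set (A : {set V}) : group_set (perp_set A).
Proof.
apply/group_setP; split=> [|x y /perpP Ax /perpP Ay]; apply/perpP=> h Ah.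
  by rewrite /omega /= !mul0r subr0.
by rewrite omegaDl Ax // Ay // addr0.
Qed.

(** The orthogonal of a set, as a subgroup. *)
Definition perp A : {group V} := Group (perp_group_set A).

Lemma sub_perp_perp (A : {set V}) : A \subset perp (perp A).
Proof.
apply/subsetP=> x Ax; apply/perpP=> h /perpP Ah.
by rewrite omega_sym Ah // oppr0.
Qed.

Lemma perp_cyclic H : exponent H == d -> cyclic (perp H).
Proof.
move=> /exponentE[v [w [Hv vw1]]]; apply: (cyclicS _ (cycle_cyclic v)).
apply/subsetP=> x /perpP Hx; rewrite (omega_basis _ _ x vw1).
rewrite [omega v x]omega_sym (Hx v) // oppr0 groupM //.
  by rewrite scal_mem ?cycle_id.
by rewrite /scal !mul0r group1.
Qed.

Lemma perp_exponent H : cyclic H -> exponent (perp H) == d.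
Proof.
move=> /cyclicP[c ->]; have [k [v [w [-> vw1]]]] := scal_unimodular c.
apply/exponentE; exists v, w; split=> //; apply/perpP=> h /cycleP[m ->].
by rewrite pairXgE !omegaZr omegaxx !mulr0.
Qed.

Lemma perpK_exponent H : exponent H == d -> perp (perp H) = H.
Proof.
move=> /exponentE[v [w [Hv vw1]]]; apply/val_inj/eqP.
rewrite eqEsubset sub_perp_perp andbT; apply/subsetP=> x /perpP Hx.
(* The residues t such that t w lies in H form an ideal, generated by some m.
   Any a with a m = 0 puts a v in perp H, so a kills omega v x. *)
pose J : {set 'Z_d} := [set t | scal t w \in H].
have gJ : group_set J.
  apply/group_setP; split=> [|a b]; rewrite !inE ?/scal ?mul0r ?group1 //.
  by move=> Ja Jb; rewrite !mulrDl; apply: (groupM Ja Jb).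
have /cyclicP[m] : cyclic (Group gJ).
  apply: (cyclicS (subsetT _)).
  by rewrite /= Zp_cycle cycle_cyclic.
rewrite [gval _]/= => Em.
have Jm : scal m w \in H.
  by have: m \in J by [rewrite Em cycle_id]; rewrite inE.
have JP t : scal t w \in H -> exists r, t = m * r.
  move=> Ht; have /cycleP[i ->] : t \in <[m]>%g by rewrite -Em inE.
  by exists i%:R; rewrite mulr_natr FinRing.zmodXgE.
have [a am0|r Er] := @Zp_annihilator d m (omega v x) d_gt1.
  rewrite -omegaZl omega_sym Hx ?oppr0 //; apply/perpP=> h Hh.
  have [|r Er] := JP (omega v h).
    (* Modulo v, h is congruent to omega v h times w. *)
    by rewrite -(groupMl _ (scal_mem _ (omega h w) _ Hv)) -omega_basis.
  by rewrite omegaZl Er mulrA am0 mul0r.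
rewrite (omega_basis _ _ x vw1) Er groupM //; first exact: scal_mem.
have -> : scal (m * r) w = scal r (scal m w).
  by rewrite /scal /=; congr pair; ring.
exact: scal_mem.
Qed.

Lemma perpK_cyclic H : cyclic H -> perp (perp H) = H.
Proof.
move=> /cyclicP[c Hc]; apply/val_inj/eqP.
rewrite eqEsubset sub_perp_perp andbT; apply/subsetP=> x /perpP Hx.
have [k [v [w [Dc vw1]]]] := scal_unimodular c.
have perpHP y : omega y c = 0 -> y \in perp H.
  move=> yc0; apply/perpP=> h; rewrite Hc => /cycleP[i ->].
  by rewrite pairXgE omegaZr yc0 mulr0.
(* Testing x against v shows that x is a multiple of v; testing it against
   the t w with t k = 0 shows that the coefficient is a multiple of k. *)
have vx0 : omega v x = 0.
  rewrite omega_sym Hx ?oppr0 // perpHP //.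
  by rewrite Dc omegaZr omegaxx mulr0.
have [t tk0|r Er] := @Zp_annihilator d k (omega x w) d_gt1.
  rewrite -omegaZr Hx // perpHP // Dc omegaZl omegaZr omega_sym vw1.
  by rewrite mulrA tk0 mul0r.
have -> : x = scal r c.
  rewrite [LHS](omega_basis v w) // vx0 Er Dc pairMgE /scal /=.
  by congr pair; ring.
by rewrite scal_mem // Hc cycle_id.
Qed.

Lemma card_exponent_cyclic :
  #|[set H : {group V} | exponent H == d]| = #|[set H : {group V} | cyclic H]|.
Proof.
have <- : (fun H : {group V} => perp H) @: [set H : {group V} | exponent H == d]
    = [set H : {group V} | cyclic H].
  apply/setP=> K; rewrite inE; apply/imsetP/idP => [[H]|cK].
    by rewrite inE => eH ->; apply: perp_cyclic.
  by exists (perp K); rewrite ?inE ?perp_exponent ?perpK_cyclic.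
apply/esym/card_in_imset=> H K; rewrite !inE => eH eK eHK.
by rewrite -(perpK_exponent _ eH) eHK perpK_exponent.
Qed.

End Plane.

(** * Reduction to the torsion subgroup *)

(** Multiplication by [m] identifies the subgroups of exponent [d] of pairs
    modulo [d] with those of pairs modulo [m * d]. *)
Lemma card_exponent_torsion (m d : nat) : (1 < d)%N -> (0 < m)%N ->
  #|[set H : {group 'Z_(m * d) * 'Z_(m * d)} | exponent H == d]|
    = #|[set H : {group 'Z_d * 'Z_d} | exponent H == d]|.
Proof.
move=> d_gt1 m_gt0; set n := (m * d)%N.
have n_gt1 : (1 < n)%N by rewrite (leq_trans d_gt1) // leq_pmull.
pose mulm (a : 'Z_d) : 'Z_n := (m * a)%:R.
have mulmD : {morph mulm : a b / a + b}.
  move=> a b; apply: ord_inj; rewrite /mulm -natrD !val_Zp_nat // -mulnDr /=.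
  by rewrite [X in (m * (_ %% X))%N](Zp_cast d_gt1) muln_modr -/n modn_mod.
have mulm_inj : injective mulm.
  move=> a b /(congr1 (@nat_of_ord _)); rewrite /mulm !val_Zp_nat //.
  have lt_n (c : 'Z_d) : (m * c < n)%N.
    by rewrite ltn_pmul2l // (leq_trans (ltn_ord c)) // Zp_cast.
  rewrite !modn_small // => /eqP; rewrite eqn_pmul2l // => /eqP.
  exact: val_inj.
have mulm_im (a : 'Z_n) : d%:R * a = 0 -> exists b, a = mulm b.
  move=> /eqP; rewrite -[a]natr_Zp -natrM Zp_natr_eq0 // => n_dvd.
  have : (d * m %| d * a)%N by rewrite [(d * m)%N]mulnC.
  rewrite dvdn_pmul2l ?(ltnW d_gt1) // => /dvdnP[b Eb]; exists b%:R.
  have bd : (b < d)%N.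
    have := ltn_ord a; rewrite [X in (_ < X)%N]Zp_cast //.
    by rewrite Eb mulnC ltn_pmul2l.
  by rewrite /mulm val_Zp_nat // modn_small // [(m * b)%N]mulnC -Eb.
pose f (x : 'Z_d * 'Z_d) : 'Z_n * 'Z_n := (mulm x.1, mulm x.2).
have fM : {in [set: 'Z_d * 'Z_d] &, {morph f : x y / (x * y)%g}}.
  by move=> x y _ _; rewrite /f !pairMgE /= !mulmD.
pose phi := Morphism fM.
have injphi : ('injm phi)%g.
  apply/injmP=> -[a b] [a' b'] _ _ eq_f.
  congr pair; apply: mulm_inj; first exact: (congr1 fst eq_f).
  exact: (congr1 snd eq_f).
have <- : (fun H : {group 'Z_d * 'Z_d} => (phi @* H)%G)
    @: [set H : {group 'Z_d * 'Z_d} | exponent H == d]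
    = [set H : {group 'Z_n * 'Z_n} | exponent H == d].
  apply/setP=> K; rewrite inE; apply/imsetP/idP => [[H]|/eqP eK].
    by rewrite inE => eH ->; rewrite exponent_injm ?subsetT.
  have sK : K \subset (phi @* setT)%g.
    apply/subsetP=> -[a b] Kx.
    have := expg_exponent Kx; rewrite eK pairXgE // => d0.
    have [a' ->] := mulm_im a (congr1 fst d0).
    have [b' ->] := mulm_im b (congr1 snd d0).
    exact: (mem_morphim phi (in_setT (a', b'))).
  have EK : K = (phi @* (phi @*^-1 K))%G.
    by apply: val_inj; rewrite /= morphpreK.
  exists (phi @*^-1 K)%G => //.
  by rewrite inE -(exponent_injm injphi) ?subsetT //= morphpreK // eK.
apply: card_in_imset => H K _ _ /(congr1 val) /= eHK.
by apply/val_inj/(injm_morphim_inj injphi); rewrite ?subsetT.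
Qed.

Lemma ZxZ_setT (n : nat) : (1 < n)%N -> ZxZ n = [set: 'Z_n * 'Z_n] :> {set _}.
Proof. by move=> n_gt1; apply/setP=> x; rewrite /= /Zp n_gt1 !inE. Qed.

(** * Subgroups of given exponent and cyclic subgroups *)

Local Close Scope ring_scope.

Theorem theorem6 (n delta : nat) (n_gt0 : 0 < n) (delta_gt0 : 0 < delta)
    (delta_dvd_n : delta %| n) :
  #|[set H in subgroups (ZxZ n) | exponent H == delta]|
    = #|[set H in subgroups (ZxZ delta) | cyclic H]|.
Proof.
have [delta_gt1|delta_le1] := ltnP 1 delta; last first.
  have -> : delta = 1 by apply/eqP; rewrite eqn_leq delta_le1.
  transitivity 1.
    rewrite -[RHS](cards1 (1%G : {group 'Z_n * 'Z_n})); apply: eq_card => H.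
    rewrite !inE -dvdn1 -trivg_exponent; apply/andP/eqP=> [[_ /eqP H1]|->].
      exact: val_inj.
    by rewrite sub1G.
  rewrite -[LHS](cards1 (1%G : {group 'Z_1 * 'Z_1})); apply/esym.
  apply: eq_card => H; rewrite !inE.
  have -> : ZxZ 1 = 1%g :> {set _}.
    by apply/setP=> -[a b]; rewrite /= /Zp !inE.
  rewrite subG1; apply/andP/eqP=> [[/eqP H1 _]|->]; first exact: val_inj.
  by rewrite eqxx cyclic1.
have /dvdnP[m En] := delta_dvd_n; subst n.
have m_gt0 : 0 < m by move: n_gt0; rewrite muln_gt0 => /andP[].
have n_gt1 : 1 < m * delta by rewrite (leq_trans delta_gt1) // leq_pmull.
have dropT k (P : pred {group 'Z_k * 'Z_k}) : 1 < k ->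
    #|[set H in subgroups (ZxZ k) | P H]| = #|[set H | P H]|.
  by move=> k_gt1; apply: eq_card => H; rewrite !inE ZxZ_setT ?subsetT.
rewrite !dropT // card_exponent_torsion //.
exact: card_exponent_cyclic.
Qed.
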